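(* Let $X\ge 0$ be a random variable with distribution function $F$ and moments $m_k=\mathbf{E}[X^k]$ (all finite), such that $m_k\ge c\,k^{(2+\varepsilon)k}$ for $k=1,2,\ldots$, for some constants $c>0$ and $\varepsilon>0$. Assume further that $X$ has a density function $f$ on $[0,\infty)$ which satisfies Condition L. Then $X$ is M-indet.
   Context: All random variables are assumed to have finite moments of all positive orders. A random variable $X$ with distribution function $F$ and moments $m_k=\mathbf{E}[X^k]$ is called moment determinate (M-det) if $F$ is the only distribution having the moment sequence $\{m_k\}_{k=1}^\infty$; otherwise it is called moment indeterminate (M-indet). Condition L (for a density $f(x)$, $x\in[0,\infty)$): for some fixed $x_0>0$, $f$ is strictly positive and differentiable for $x>x_0$, and the function $L_f(x):=-\dfrac{x f'(x)}{f(x)}$ increases monotonically to $\infty$ as $x\to\infty$, $x>x_0$. *)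

(* Defs.v *)
From HB Require Import structures.
From mathcomp Require Import all_boot all_order all_algebra.
From mathcomp Require Import all_classical all_reals all_analysis.

Set Implicit Arguments.
Unset Strict Implicit.
Unset Printing Implicit Defensive.

Import Order.TTheory GRing.Theory Num.Theory.
Import numFieldNormedType.Exports.

Local Open Scope classical_set_scope.
Local Open Scope ring_scope.

Definition finite_moments d (T : measurableType d) (R : realType)
    (P : probability T R) (X : T -> R) : Prop :=
  forall k : nat, P.-integrable setT (fun t => (X t ^+ k)%:E).

Definition moment d (T : measurableType d) (R : realType)
    (P : probability T R) (X : T -> R) (k : nat) : \bar R :=
  'E_P[fun t => X t ^+ k].

(* The competing laws [nu] range over all probability measures on the real
   line, also when [X] is nonnegative. They are compared with the law of [X] on
   Borel sets only, since Rocq measures also take (irrelevant) values on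
   nonmeasurable sets. *)
Definition M_det d (T : measurableType d) (R : realType)
    (P : probability T R) (X : {RV P >-> R}) : Prop :=
  forall nu : probability R R,
    finite_moments nu idfun ->
    (forall k : nat, (0 < k)%N ->
       moment nu idfun k = moment P X k) ->
    forall A : set R, measurable A -> nu A = distribution P X A.

Definition M_indet d (T : measurableType d) (R : realType)
    (P : probability T R) (X : {RV P >-> R}) : Prop := ~ M_det X.

(* The values of [f] on the negative half-line are irrelevant. *)
Definition has_density_on_nneg d (T : measurableType d) (R : realType)
    (P : probability T R) (X : {RV P >-> R}) (f : R -> R) : Prop :=
  [/\ measurable_fun (`[0, +oo[%classic : set R) f,
      (forall x, 0 <= x -> 0 <= f x) &
      forall A : set R, measurable A ->
        distribution P X A =
        (\int[lebesgue_measure]_(x in A `&` `[0%R, +oo[) (f x)%:E)%E].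

Definition L_fun (R : realType) (f : R -> R) (x : R) : R :=
  - (x * (f^`())%classic x / f x).

(* "Increases" is read in the weak sense (nondecreasing). *)
Definition condition_L (R : realType) (f : R -> R) : Prop :=
  exists x0 : R,
    [/\ 0 < x0,
        (forall x, x0 < x -> 0 < f x /\ derivable f x 1),
        (forall x y, x0 < x -> x <= y -> L_fun f x <= L_fun f y) &
        L_fun f x @[x --> +oo] --> +oo].

(* Main.v *)
Require Import Defs.
From HB Require Import structures.
From mathcomp Require Import all_boot all_order all_algebra.
From mathcomp Require Import all_classical all_reals all_analysis.
From mathcomp Require Import measurable_realfun.
From mathcomp Require Import ring lra.

(** A positive lower bound of the form [C * exp (- A * x ^ al)] with [al < 1/2]
    on the tail of the density leaves room for a perturbation that no
    polynomial detects; condition L is what turns the growth of the moments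
    into such a bound.

    Lower bound.  In the variable [ln x] the function [ln f] is concave beyond
    [x0], with slope [- L_fun f].  So [f] lies below its tangent at [y], which
    in the variable [x] is the power [f y * (y / x) ^ L] with [L = L_fun f y]
    ([powR_tangent]).  For an integer [k] with [k + 2 <= L <= k + 3], integrating
    [x ^ k] against this power gives
    [m_k <= a ^ k + pi * f y * y ^ (k + 3)] ([moment_le_density]).  The lower
    bound on [m_k] then makes [f y] at least a constant times
    [k ^ (s * k) / y ^ (k + 3)] where [s = 2 + eps], and by [ln t <= t] this is
    at least [exp (- 4 * s * y ^ (1 / s))] for every value of [k].
    Since [L_fun f] tends to infinity, every large [y] has such a [k] that is
    large enough ([density_ge_expR_powR]).

    Perturbation.  Put [al = 1 / s < 1/2].  Rotating the half-line of
    integration shows that the integral over [x > 0] of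
    [x ^ k * exp (- lam * x ^ al * e ^ (i * th))] equals its value at [th = 0]
    times [e ^ (- i * th * (k + 1) / al)].  At [th = pi * al] this
    factor is [(-1) ^ (k + 1)], so the imaginary part
    [exp (- lam * cos th * x ^ al) * sin (lam * sin th * x ^ al)], up to sign,
    has all its moments equal to zero.  As [al < 1/2], [cos th] is positive, and
    for [lam] large enough a small multiple of this function, translated to the
    tail, is dominated by [f] ([integral_moment_null_kernel]).

    Adding this multiple to [f] gives another probability density with the same
    moments ([M_indet_perturbation]). *)

Set Implicit Arguments.
Unset Strict Implicit.
Unset Printing Implicit Defensive.

Import Order.TTheory GRing.Theory Num.Theory.
Import numFieldNormedType.Exports.

Local Open Scope classical_set_scope.
Local Open Scope ring_scope.

(** * Laws with a density *)

Lemma probability_of_density (d : measure_display) (T : measurableType d)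
    (R : realType) (mu : {measure set T -> \bar R}) (w : T -> R) :
    measurable_fun setT w -> (forall x, 0 <= w x) ->
    (\int[mu]_x (w x)%:E = 1)%E ->
  exists nu : probability T R,
    forall A, nu A = (\int[mu]_(x in A) (w x)%:E)%E.
Proof.
move=> mw w0 w1.
pose nu (A : set T) : \bar R := (\int[mu]_(x in A) (w x)%:E)%E.
have nu0 : nu set0 = 0%E by rewrite /nu integral_set0.
have nu_ge0 A : (0 <= nu A)%E by apply: integral_ge0 => x _; rewrite lee_fin.
have nu_additive : semi_sigma_additive nu.
  move=> F mF tF mUF; rewrite /nu ge0_integral_bigcup//.
  - apply: is_cvg_ereal_nneg_natsum_cond => n _ _; exact: nu_ge0.
  - by apply/measurable_EFinP; exact: measurable_funTS.
  - by move=> x _; rewrite lee_fin.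
pose nuM := isMeasure.Build _ _ _ nu nu0 nu_ge0 nu_additive.
pose nu' : {measure set T -> \bar R} := HB.pack nu nuM.
have nuT : nu' setT = 1%E by exact: w1.
pose nuP := Measure_isProbability.Build _ _ _ nu' nuT.
pose nu'' : probability T R := HB.pack nu nuM nuP.
by exists nu''.
Qed.

Section density.
Context d (T : measurableType d) (R : realType).
Variables (nu : {finite_measure set T -> \bar R}).
Variables (mu : {sigma_finite_measure set T -> \bar R}) (w : T -> R).
Hypotheses (mw : measurable_fun setT w) (w_ge0 : forall x, 0 <= w x).
Hypothesis nuE :
  forall A, measurable A -> nu A = (\int[mu]_(x in A) (w x)%:E)%E.

Let nu_mu : nu `<< mu.
Proof.
apply/null_content_dominatesP => A mA A0; rewrite nuE// null_set_integral//.
by apply/measurable_EFinP; exact: measurable_funTS.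
Qed.

(** The Radon-Nikodym derivative agrees almost everywhere with any function
    having the same integrals; this reduces integration against [w] to the
    change of variables for Radon-Nikodym derivatives. *)
Let ae_eq_RN : ae_eq mu setT (Radon_Nikodym_SigmaFinite.f nu mu) (EFin \o w).
Proof.
apply: integral_ae_eq => //.
- exact: Radon_Nikodym_SigmaFinite.f_integrable.
- exact/measurable_EFinP.
- by move=> E _ mE; rewrite -Radon_Nikodym_SigmaFinite.f_integral// nuE.
Qed.

Let mRN : measurable_fun setT (Radon_Nikodym_SigmaFinite.f nu mu).
Proof. exact: measurable_int (Radon_Nikodym_SigmaFinite.f_integrable nu_mu). Qed.

Lemma ge0_integral_density (g : T -> \bar R) :
    measurable_fun setT g -> (forall x, 0 <= g x)%E ->
  (\int[nu]_x g x = \int[mu]_x (g x * (w x)%:E))%E.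
Proof.
move=> mg g0.
rewrite -(Radon_Nikodym_SigmaFinite.change_of_variables nu_mu)//.
apply: ae_eq_integral => //.
- exact: emeasurable_funM.
- by apply: emeasurable_funM => //; exact/measurable_EFinP.
- exact: ae_eqe_mul2l.
Qed.

Lemma integrable_density (g : T -> R) : measurable_fun setT g ->
  nu.-integrable setT (EFin \o g) <->
  mu.-integrable setT (fun x => (g x * w x)%:E).
Proof.
move=> mg.
have E : (\int[nu]_x `|(g x)%:E| = \int[mu]_x `|(g x * w x)%:E|)%E.
  rewrite ge0_integral_density//.
    by apply: eq_integral => x _; rewrite EFinM abseM; congr (_ * _)%E; rewrite gee0_abs ?lee_fin.
  by apply: measurableT_comp => //; exact/measurable_EFinP.
split=> /integrableP[_ h]; apply/integrableP; split.
- by apply/measurable_EFinP; exact: measurable_funM.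
- by rewrite -E.
- exact/measurable_EFinP.
- by rewrite E.
Qed.

Lemma integral_density (g : T -> R) : measurable_fun setT g ->
    nu.-integrable setT (EFin \o g) ->
  (\int[nu]_x (g x)%:E = \int[mu]_x (g x * w x)%:E)%E.
Proof.
move=> mg ig.
have eg : (EFin \o (fun x => g x * w x)) = (fun x => (g x)%:E * (w x)%:E)%E.
  by apply/funext => x; rewrite /= EFinM.
rewrite -(Radon_Nikodym_change_of_variables nu_mu)//.
apply: ae_eq_integral => //.
- by apply: emeasurable_funM => //; exact/measurable_EFinP.
- by apply/measurable_EFinP; exact: measurable_funM.
- rewrite -[X in ae_eq _ _ _ X]/(EFin \o (fun x => g x * w x)) eg.
  apply: ae_eqe_mul2l; apply: ae_eq_trans ae_eq_RN.
  exact/ae_eq_sym/ae_eq_Radon_Nikodym_SigmaFinite.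
Qed.

End density.

(** Lebesgue measure is defined on the sigma-algebra generated by the half-open
    intervals, which carries another display than the Borel sigma-algebra of
    [R]; the measure is transported along the identity. *)
Lemma borel_probability_of_density (R : realType) (w : R -> R) :
    measurable_fun setT w -> (forall x, 0 <= w x) ->
    (\int[lebesgue_measure]_x (w x)%:E = 1)%E ->
  exists nu : probability R R,
    forall A, nu A = (\int[lebesgue_measure]_(x in A) (w x)%:E)%E.
Proof.
move=> mw w0 w1.
have [nu nuE] := @probability_of_density _ (measurableTypeR R) R
   lebesgue_measure w mw w0 w1.
have mid : measurable_fun setT (idfun : measurableTypeR R -> R).
  exact: (@measurable_id _ (measurableTypeR R) setT).
pose idX : {mfun measurableTypeR R >-> R} := HB.pack (idfun : measurableTypeR R -> R)
  (isMeasurableFun.Build _ _ _ _ _ mid).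
by exists (distribution nu idX) => A; rewrite -nuE.
Qed.

Section law_density.
Context (R : realType) (d : measure_display) (T : measurableType d).
Variables (P : probability T R) (X : T -> R).
Hypothesis mX : measurable_fun setT X.
Variable w : R -> R.
Hypotheses (mw : measurable_fun setT w) (w_ge0 : forall x, 0 <= w x).
Hypothesis wE : forall A : set R, measurable A ->
  P (X @^-1` A) = (\int[lebesgue_measure]_(x in A) (w x)%:E)%E.

(** The law is taken on the measurable space on which Lebesgue measure is
   defined. *)
Let mX' : measurable_fun setT (X : T -> measurableTypeR R).
Proof. exact: mX. Qed.

Let X' : {mfun T >-> measurableTypeR R} := HB.pack (X : T -> measurableTypeR R)
  (isMeasurableFun.Build _ _ _ _ _ mX').

Let law : probability (measurableTypeR R) R := distribution P X'.

Let lawE A : measurable A -> law A = (\int[lebesgue_measure]_(x in A) (w x)%:E)%E.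
Proof. by move=> mA; rewrite -wE. Qed.

Let mw' : measurable_fun setT (w : measurableTypeR R -> R).
Proof. exact: mw. Qed.

Lemma integrable_density_of_law (g : R -> R) : measurable_fun setT g ->
    P.-integrable setT (fun t => (g (X t))%:E) <->
  lebesgue_measure.-integrable setT (fun x => (g x * w x)%:E).
Proof.
move=> mg; have mg' : measurable_fun setT (g : measurableTypeR R -> R) by exact: mg.
rewrite -(@integrable_density _ (measurableTypeR R) R law lebesgue_measure _ mw' w_ge0 lawE _ mg').
have mgE : measurable_fun [set: measurableTypeR R] (EFin \o g).
  by apply/measurable_EFinP; exact: mg'.
have E : (\int[law]_x `|(EFin \o g) x| = \int[P]_t `|(g (X t))%:E|)%E.
  by rewrite ge0_integral_distribution//; exact: measurableT_comp.
split=> /integrableP[_ h]; apply/integrableP; split=> //.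
- by rewrite E.
- by apply/measurable_EFinP; exact: measurableT_comp mg mX.
- by rewrite -E.
Qed.

Lemma integral_density_of_law (g : R -> R) : measurable_fun setT g ->
    P.-integrable setT (fun t => (g (X t))%:E) ->
  (\int[P]_t (g (X t))%:E = \int[lebesgue_measure]_x (g x * w x)%:E)%E.
Proof.
move=> mg ig; have mg' : measurable_fun setT (g : measurableTypeR R -> R) by exact: mg.
have mgE : measurable_fun [set: measurableTypeR R] (EFin \o g).
  by apply/measurable_EFinP; exact: mg'.
rewrite -(@integral_density _ (measurableTypeR R) R law lebesgue_measure _ mw' lawE _ mg').
  by rewrite (@integral_distribution _ _ _ _ _ P X' (EFin \o g)).
apply/(@integrable_density _ (measurableTypeR R) R law lebesgue_measure _ mw' w_ge0 lawE _ mg').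
exact/integrable_density_of_law.
Qed.

End law_density.

(** * Perturbing a density without changing its moments *)

Section perturbation.
Context (R : realType) (d : measure_display) (T : measurableType d).
Variables (P : probability T R) (X : {RV P >-> R}).
Hypothesis X_moments : finite_moments P X.
Variable w : R -> R.
Hypotheses (mw : measurable_fun setT w) (w_ge0 : forall x, 0 <= w x).
Hypothesis wE : forall A : set R, measurable A ->
  P (X @^-1` A) = (\int[lebesgue_measure]_(x in A) (w x)%:E)%E.

Let mX (k : nat) : measurable_fun setT (fun x : R => x ^+ k).
Proof. exact: exprn_measurable. Qed.

Let mX1 : measurable_fun setT (X : T -> R).
Proof. exact: measurable_funP. Qed.

Lemma integrable_moment_density k :
  lebesgue_measure.-integrable setT (fun x : R => (x ^+ k * w x)%:E).
Proof. exact/(integrable_density_of_law mX1 mw w_ge0 wE (mX k))/X_moments. Qed.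

Lemma moment_density k :
  moment P X k = (\int[lebesgue_measure]_x (x ^+ k * w x)%:E)%E.
Proof.
rewrite -(integral_density_of_law mX1 mw w_ge0 wE (mX k)); first by rewrite /moment unlock.
exact: X_moments.
Qed.

(** The law with density [w + h] has the moments of [X], and it gives [A] a mass
    other than that of the law of [X]. *)
Lemma M_indet_perturbation (h : R -> R) (A : set R) :
    measurable_fun setT h -> (forall x, `|h x| <= w x) ->
    (forall k, \int[lebesgue_measure]_x (x ^+ k * h x)%:E = 0)%E ->
    measurable A -> (\int[lebesgue_measure]_(x in A) (h x)%:E)%E <> 0%E ->
  M_indet X.
Proof.
move=> mh hw h0 mA hA Mdet.
have ih k : lebesgue_measure.-integrable setT (fun x : R => (x ^+ k * h x)%:E).
  apply: le_integrable (integrable_moment_density k) => //.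
    by apply/measurable_EFinP; exact: measurable_funM.
  move=> x _ /=; rewrite lee_fin !normrM ler_wpM2l//.
  by rewrite (le_trans (hw x))// ler_norm.
pose v x := w x + h x.
have mv : measurable_fun setT v by exact: measurable_funD.
have v_ge0 x : 0 <= v x.
  by have := hw x; rewrite ler_norml => /andP[+ _]; rewrite /v; lra.
have vE k : (\int[lebesgue_measure]_x (x ^+ k * v x)%:E = moment P X k)%E.
  rewrite moment_density.
  transitivity (\int[lebesgue_measure]_x
      ((x ^+ k * w x)%:E + (x ^+ k * h x)%:E))%E.
    by apply: eq_integral => x _; rewrite -EFinD -mulrDr.
  rewrite integralD//; last exact: integrable_moment_density.
  by rewrite h0 adde0.
have [|nu nuE] := borel_probability_of_density mv v_ge0.
  transitivity (\int[lebesgue_measure]_x (x ^+ 0 * v x)%:E)%E.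
    by apply: eq_integral => x _; rewrite expr0 mul1r.
  rewrite vE /moment; under eq_fun do rewrite expr0.
  by rewrite expectation_cst.
have mid : measurable_fun setT (idfun : R -> R) by exact: measurable_id.
have nuE' (B : set R) : measurable B ->
  nu (idfun @^-1` B) = (\int[lebesgue_measure]_(x in B) (v x)%:E)%E by [].
have iv k : nu.-integrable setT (EFin \o (fun x : R => x ^+ k)).
  apply/(integrable_density_of_law mid mv v_ge0 nuE' (mX k)).
  have -> : (fun x => (x ^+ k * v x)%:E) =
      ((fun x => (x ^+ k * w x)%:E) \+ (fun x => (x ^+ k * h x)%:E))%E.
    by apply/funext => x; rewrite /= -EFinD -mulrDr.
  by apply: integrableD => //; exact: integrable_moment_density.
have := Mdet nu iv.
have numom k : (0 < k)%N -> moment nu idfun k = moment P X k.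
  move=> _; rewrite -vE -(integral_density_of_law mid mv v_ge0 nuE' (mX k)).
    by rewrite /moment unlock.
  exact: iv.
move=> /(_ numom A mA); rewrite nuE -[distribution P X A]/(P (X @^-1` A)) wE// => ve.
have iw0 : lebesgue_measure.-integrable A (EFin \o w).
  apply: (@integrableS _ _ _ _ setT) => //.
  by apply: eq_integrable (integrable_moment_density 0) => // x _; rewrite expr0 mul1r.
have ih0 : lebesgue_measure.-integrable A (EFin \o h).
  apply: (@integrableS _ _ _ _ setT) => //.
  by apply: eq_integrable (ih 0) => // x _; rewrite expr0 mul1r.
have vA : (\int[lebesgue_measure]_(x in A) (v x)%:E =
    \int[lebesgue_measure]_(x in A) (w x)%:E + \int[lebesgue_measure]_(x in A) (h x)%:E)%E.
  by rewrite -integralD//.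
have iwf : (\int[lebesgue_measure]_(x in A) (w x)%:E)%E \is a fin_num.
  exact: integrable_fin_num.
have cancel (I J : \bar R) : I \is a fin_num -> (I + J = I)%E -> J = 0%E.
  by move=> fI IJ; rewrite -(addeK J fI) (addeC J) IJ subee.
apply: hA; apply: (cancel _ _ iwf); rewrite -vA; exact: ve.
Qed.
End perturbation.

(** * Lower bound for the density *)

Section tangent.
Context {R : realType}.
Variables (f : R -> R) (x0 : R).
Hypothesis x0_gt0 : 0 < x0.
Hypothesis f_reg : forall x, x0 < x -> 0 < f x /\ derivable f x 1.
Hypothesis L_nd : forall x y, x0 < x -> x <= y -> L_fun f x <= L_fun f y.

(** The right-hand side is the value at [y] of the function
    [z => f z * z ^ L_fun f y], whose derivative has the sign of
    [L_fun f y - L_fun f z]: it increases up to [y] and decreases after [y]. *)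
Lemma powR_tangent x y : x0 < x -> x0 < y ->
  f x * x `^ L_fun f y <= f y * y `^ L_fun f y.
Proof.
move=> x0x x0y; set L := L_fun f y.
pose F z := f z * z `^ L.
pose F' z := z `^ (L - 1) * f z * (L - L_fun f z).
have dF z : x0 < z -> is_derive z 1 F (F' z).
  move=> x0z; have z0 : 0 < z := lt_trans x0_gt0 x0z.
  have [fz0 fz] := f_reg x0z.
  have df : is_derive z 1 f ((f^`())%classic z).
    by apply: DeriveDef => //; rewrite derive1E.
  have dp := @is_derive1_powR R L z z0.
  apply: (is_derive_eq (is_deriveM df dp)).
  have -> : z `^ L = z * z `^ (L - 1).
    by rewrite powRB ?powRr1 ?(ltW z0) ?(gt_eqF z0) ?implybT// mulrCA divff ?mulr1 ?gt_eqF.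
  rewrite /F' /L_fun /GRing.scale /=; field.
  exact: lt0r_neq0.
have F'_ge0 z : x0 < z -> z <= y -> 0 <= F' z.
  move=> x0z zy; rewrite !mulr_ge0 ?powR_ge0//; first by rewrite ltW//; case: (f_reg x0z).
  by rewrite subr_ge0 L_nd.
have F'_le0 z : y <= z -> F' z <= 0.
  move=> yz; rewrite mulr_ge0_le0 ?mulr_ge0 ?powR_ge0//.
    by rewrite ltW//; case: (f_reg (lt_le_trans x0y yz)).
  by rewrite subr_le0 L_nd.
have cF u v : x0 < u -> {within `[u, v], continuous F}.
  move=> x0u; apply: derivable_within_continuous => z.
  rewrite in_itv /= => /andP[uz _].
  by case: (dF z (lt_le_trans x0u uz)).
rewrite -/(F x) -/(F y) -subr_ge0.
have [xy|yx|->] := ltgtP x y; last by rewrite subrr.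
- have dxy z : z \in `]x, y[ -> is_derive z 1 F (F' z).
    by rewrite in_itv /= => /andP[xz _]; exact/dF/(lt_trans x0x).
  have [z] := MVT xy dxy (cF x y x0x).
  rewrite in_itv /= => /andP[xz zy] ->.
  rewrite mulr_ge0 ?subr_ge0 ?(ltW xy)// F'_ge0 ?(ltW zy)//.
  exact: lt_trans xz.
- have dyx z : z \in `]y, x[ -> is_derive z 1 F (F' z).
    by rewrite in_itv /= => /andP[yz _]; exact/dF/(lt_trans x0y).
  have [z] := MVT yx dyx (cF y x x0y).
  rewrite in_itv /= => /andP[yz zx] e; rewrite -opprB e oppr_ge0.
  by rewrite mulr_le0_ge0 ?subr_ge0 ?F'_le0 ?(ltW yx) ?(ltW yz).
Qed.

(** Below [a] nothing is known on [f], so [x ^ k] is bounded by [a ^ k]; above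
    [a] the tangent power at [y] gives a factor [x ^ (k - L)] with
    [k - L <= -2], and the bound [k + 3] on [L] is used for the power of [y]. *)
Lemma monomial_density_le (a x y : R) (k : nat) : x0 <= a -> 1 <= a -> x0 < y -> 1 <= y ->
  k%:R + 2 <= L_fun f y -> L_fun f y <= k%:R + 3 -> 0 <= x -> 0 <= f x ->
  x ^+ k * f x <= a ^+ k * f x + f y * y ^+ (k + 3) * (2 * (1 + x ^+ 2)^-1).
Proof.
move=> x0a a1 x0y y1 kL Lk x_ge0 fx_ge0.
have fy0 : 0 < f y by case: (f_reg x0y).
have y0 : 0 < y by lra.
have q0 : 0 <= 2 * (1 + x ^+ 2)^-1.
  by rewrite mulr_ge0// invr_ge0 addr_ge0// sqr_ge0.
have [xa|ax] := leP x a.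
  rewrite (@le_trans _ _ (a ^+ k * f x))//.
    by rewrite ler_wpM2r// lerXn2r ?nnegrE//; lra.
  by rewrite lerDl mulr_ge0// mulr_ge0 ?exprn_ge0// ltW.
have x1 : 1 <= x by lra.
have x0' : 0 < x by lra.
apply: (@le_trans _ _ (f y * y ^+ (k + 3) * (2 * (1 + x ^+ 2)^-1))); last first.
  by rewrite lerDr mulr_ge0// exprn_ge0//; lra.
apply: (@le_trans _ _ (f y * y ^+ (k + 3) * x ^- 2)); last first.
  rewrite ler_wpM2l ?mulr_ge0 ?exprn_ge0 ?(ltW fy0) ?(ltW y0)//.
  have x2 : 1 <= x ^+ 2 by rewrite expr_ge1// ltW.
  rewrite ler_pdivlMr; last by lra.
  by rewrite ler_pdivrMl; [lra|lra].
rewrite ler_pdivlMr ?exprn_gt0// mulrAC -exprD mulrC.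
apply: (@le_trans _ _ (f x * x `^ L_fun f y)).
  rewrite ler_pM2l; last by case: (f_reg (le_lt_trans x0a ax)).
  by rewrite -powR_mulrn ?(ltW x0')// ler_powR// natrD.
apply: (le_trans (powR_tangent (le_lt_trans x0a ax) x0y)).
rewrite ler_pM2l//.
by rewrite -powR_mulrn ?(ltW y0)// ler_powR// natrD.
Qed.
End tangent.

Section moment_bound.
Context (R : realType) (d : measure_display) (T : measurableType d).
Variables (P : probability T R) (X : {RV P >-> R}) (f : R -> R).
Hypotheses (X_moments : finite_moments P X) (f_density : has_density_on_nneg X f).

Let w : R -> R := f \_ `[0, +oo[.

Lemma measurable_density : measurable_fun setT w.
Proof.
have [mf _ _] := f_density.
by apply/(measurable_restrict _ _ _).1 => //; rewrite setTI.
Qed.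

Lemma density_ge0 x : 0 <= w x.
Proof.
have [_ f0 _] := f_density; rewrite /w patchE; case: ifPn => //.
by rewrite inE /= in_itv /= andbT => /f0.
Qed.

Lemma law_density (A : set R) : measurable A ->
  P (X @^-1` A) = (\int[lebesgue_measure]_(x in A) (w x)%:E)%E.
Proof.
move=> mA; have [_ _ fE] := f_density.
rewrite -[LHS]/(distribution P X A) fE// integral_mkcondr.
by apply: eq_integral => x _; rewrite restrict_EFin.
Qed.

Lemma moment_le_of_bound (q : R -> R) (a C : R) (k : nat) :
    measurable_fun (`[0, +oo[%classic : set R) q -> (forall x, 0 <= q x) ->
    0 <= a -> 0 <= C ->
    (forall x, 0 <= x -> x ^+ k * f x <= a * f x + C * q x) ->
  (moment P X k <= a%:E + C%:E * \int[lebesgue_measure]_(x in `[0%R, +oo[) (q x)%:E)%E.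
Proof.
move=> mq q0 a0 C0 fq.
have [mf f0 fE] := f_density.
have fT : (\int[lebesgue_measure]_(x in `[0%R, +oo[) (f x)%:E = 1)%E.
  by have := fE _ measurableT; rewrite setTI probability_setT => <-.
rewrite (moment_density X_moments measurable_density density_ge0 law_density).
have -> : (\int[lebesgue_measure]_x (x ^+ k * w x)%:E =
    \int[lebesgue_measure]_(x in `[0%R, +oo[) (x ^+ k * f x)%:E)%E.
  rewrite [RHS]integral_mkcond; apply: eq_integral => x _.
  by rewrite /w !patchE; case: ifPn => //; rewrite mulr0.
have fe x : (`[0, +oo[%classic : set R) x -> 0 <= f x.
  by rewrite /= in_itv /= andbT; exact: f0.
rewrite -[X in (X%:E + _)%E]mulr1 EFinM -fT -!ge0_integralZl//.
- rewrite -ge0_integralD//.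
  + apply: ge0_le_integral => //.
    * by move=> x /[dup] /fe fx0 /=; rewrite in_itv /= andbT => x0; rewrite lee_fin mulr_ge0 ?exprn_ge0.
    * by apply/measurable_EFinP; apply: measurable_funM => //; exact/measurable_funTS/exprn_measurable.
    * by apply: emeasurable_funD; apply/measurable_funeM/measurable_EFinP.
    * by move=> x /=; rewrite in_itv /= andbT => x0; rewrite lee_fin fq.
  + by move=> x /fe fx0; rewrite mule_ge0 ?lee_fin.
  + exact/measurable_funeM/measurable_EFinP.
  + by move=> x _; rewrite mule_ge0 ?lee_fin.
  + exact/measurable_funeM/measurable_EFinP.
- exact/measurable_EFinP.
- by move=> x _; rewrite lee_fin.
- exact/measurable_EFinP.
Qed.
End moment_bound.

(** The constant [pi] is the integral over the half-line of
    [2 / (1 + x ^ 2)]. *)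
Lemma moment_le_density (R : realType) (d : measure_display) (T : measurableType d)
    (P : probability T R) (X : {RV P >-> R}) (f : R -> R) (x0 a y : R) (k : nat) :
    finite_moments P X -> has_density_on_nneg X f ->
    0 < x0 -> (forall x, x0 < x -> 0 < f x /\ derivable f x 1) ->
    (forall x y, x0 < x -> x <= y -> L_fun f x <= L_fun f y) ->
    x0 <= a -> 1 <= a -> x0 < y -> 1 <= y ->
    k%:R + 2 <= L_fun f y -> L_fun f y <= k%:R + 3 ->
  (moment P X k <= (a ^+ k + pi * (f y * y ^+ (k + 3)))%:E)%E.
Proof.
move=> Xm fd x0_gt0 f_reg L_nd x0a a1 x0y y1 kL Lk.
have y0 : 0 <= y by lra.
have fy0 : 0 <= f y by rewrite ltW//; case: (f_reg _ x0y).
have mq : measurable_fun (`[0, +oo[%classic : set R) (fun x : R => (oneDsqr x)^-1).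
  have mV : measurable_fun setT (fun x : R => (oneDsqr x)^-1).
    by apply: continuous_measurable_fun; exact: continuous_oneDsqrV.
  exact: measurable_funTS.
have q0 (x : R) : 0 <= (oneDsqr x)^-1 by rewrite invr_ge0 (le_trans ler01)// oneDsqr_ge1.
have := @moment_le_of_bound R _ _ P X f Xm fd (fun x => (oneDsqr x)^-1) (a ^+ k)
  (2 * (f y * y ^+ (k + 3))) k mq q0.
rewrite integral0y_oneDsqr -EFinM -EFinD => H.
rewrite (_ : pi * _ = 2 * (f y * y ^+ (k + 3)) * (pi / 2)); last by field.
apply: H.
- by rewrite exprn_ge0//; lra.
- by rewrite !mulr_ge0// exprn_ge0.
move=> x x_ge0; have [_ f0 _] := fd.
have := monomial_density_le x0_gt0 f_reg L_nd x0a a1 x0y y1 kL Lk x_ge0 (f0 x x_ge0).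
by rewrite /oneDsqr mulrCA mulrA.
Qed.

(** When [k] is large, [a ^ k] is at most half of [c * k ^ (s * k)] and can be
    absorbed. *)
Lemma powR_self_ge (R : realType) (s a c u : R) (k : nat) : 1 <= s -> 1 <= a -> 0 < c ->
  (0 < k)%N -> a * (1 + 2 / c) <= k%:R ->
  c * k%:R `^ (s * k%:R) <= a ^+ k + u -> c / 2 * k%:R `^ (s * k%:R) <= u.
Proof.
move=> s1 a1 c0 k0 ak.
rewrite powRrM powR_mulrn ?powR_ge0// => H.
have k1 : 1 <= k%:R :> R by rewrite ler1n.
suff : a ^+ k <= c / 2 * (k%:R `^ s) ^+ k by lra.
have t0 : 0 < 2 / c by rewrite divr_gt0.
have h : (a * (1 + 2 / c)) ^+ k <= (k%:R `^ s) ^+ k.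
  rewrite lerXn2r ?nnegrE ?powR_ge0//; first by rewrite mulr_ge0//; lra.
  by rewrite (le_trans ak)// le1r_powR.
have h2 : 2 / c <= (1 + 2 / c) ^+ k.
  rewrite (@le_trans _ _ (1 + 2 / c))//; first by lra.
  by rewrite -[leLHS]expr1 ler_weXn2l//; lra.
rewrite mulrC -ler_pdivrMr ?divr_gt0// invf_div (le_trans _ h)//.
by rewrite exprMn ler_wpM2l// exprn_ge0//; lra.
Qed.

(** The minimum over [k] of [k ^ k / t ^ k] is about [exp (- t / e)].  With
    [t = y ^ (1 / s)] this bounds the power [y ^ k]; the three spare powers of
    [y] cost [3 * s * ln t <= 3 * s * t] in the exponent. *)
Lemma powR_self_exp_le (R : realType) (s y : R) (k : nat) : 0 < s -> 1 <= y -> (0 < k)%N ->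
  y ^+ (k + 3) * expR (- (4 * s * y `^ s^-1)) <= k%:R `^ (s * k%:R).
Proof.
move=> s0 y1 k0.
have y0 : 0 < y by lra.
have k0' : 0 < k%:R :> R by rewrite ltr0n.
pose W := y `^ s^-1.
have W0 : 0 < W by exact: powR_gt0.
have lyE : ln y = s * ln W by rewrite /W ln_powR mulrA divff ?mul1r// gt_eqF.
have -> : y ^+ (k + 3) = expR ((k%:R + 3) * (s * ln W)).
  have e : k%:R + 3 = (k + 3)%:R :> R by rewrite natrD.
  by rewrite -lyE e expRM_natl lnK.
have -> : k%:R `^ (s * k%:R) = expR (s * k%:R * ln k%:R) by rewrite /powR gt_eqF.
rewrite -/W -expRD ler_expR.
have h1 : ln W <= W by rewrite ltW// ln_sublinear.
have h2 : k%:R * ln W <= k%:R * ln k%:R + W.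
  have : ln (W / k%:R) <= W / k%:R by rewrite ltW// ln_sublinear// divr_gt0.
  rewrite ln_div ?posrE// ler_pdivlMr//; lra.
have h3 : s * (k%:R * ln W + 3 * ln W) <= s * (k%:R * ln k%:R + 4 * W).
  by rewrite ler_pM2l//; lra.
lra.
Qed.

Lemma density_ge_expR_powR (R : realType) (d : measure_display) (T : measurableType d)
    (P : probability T R) (X : {RV P >-> R}) (X_moments : finite_moments P X)
    (c eps : R) (c_gt0 : 0 < c) (eps_gt0 : 0 < eps)
    (moment_growth : forall k : nat, (0 < k)%N ->
       ((c * (k%:R `^ ((2 + eps) * k%:R)))%:E <= moment P X k)%E)
    (f : R -> R) (f_density : has_density_on_nneg X f) (f_L : condition_L f) :
  exists x1 C : R, [/\ 1 <= x1, 0 < C & forall x, x1 <= x ->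
    C * expR (- (4 * (2 + eps) * x `^ (2 + eps)^-1)) <= f x].
Proof.
have [x0 [x0_gt0 f_reg L_nd Loo]] := f_L.
pose a := Num.max x0 1.
have x0a : x0 <= a by rewrite /a le_max lexx.
have a1 : 1 <= a by rewrite /a le_max lexx orbT.
have [M [_ LM]] := (cvgryPge _).1 Loo (a * (1 + 2 / c) + 4).
pose x1 := Num.max (M + 1) (a + 1).
have x1M : M + 1 <= x1 by rewrite /x1 le_max lexx.
have x1a : a + 1 <= x1 by rewrite /x1 le_max lexx orbT.
exists x1, (c / 2 / pi); split; first by lra.
  by rewrite !divr_gt0 ?pi_gt0.
move=> y x1y; have y1 : 1 <= y by lra.
have x0y : x0 < y by lra.
have Ly : a * (1 + 2 / c) + 4 <= L_fun f y by apply: LM; lra.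
have t0 : 0 < 2 / c by rewrite divr_gt0.
have a2 : 1 <= a * (1 + 2 / c) by rewrite -[leLHS]mulr1 ler_pM//; lra.
have L0 : 0 <= L_fun f y by lra.
(* [k] is the integer part of [L_fun f y] minus two. *)
have := truncnS_gt (L_fun f y); have := truncn_le (L_fun f y); rewrite L0.
case: (Num.truncn (L_fun f y)) => [|[|k]]; [rewrite ?mulr1n; lra|rewrite ?mulr1n; lra|].
rewrite -addn2 -addSn -addn1 !natrD => kL Lk.
have k0 : (0 < k)%N by rewrite -(ltr_nat R); lra.
have kL' : k%:R + 2 <= L_fun f y by lra.
have Lk' : L_fun f y <= k%:R + 3 by lra.
have ak : a * (1 + 2 / c) <= k%:R by lra.
have H := moment_le_density X_moments f_density x0_gt0 f_reg L_nd x0a a1 x0y y1 kL' Lk'.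
have := le_trans (moment_growth k k0) H; rewrite lee_fin => {}H.
have s1 : 1 <= 2 + eps by lra.
have := powR_self_ge s1 a1 c_gt0 k0 ak H.
have s0 : 0 < 2 + eps by lra.
have c20 : 0 < c / 2 by lra.
have := powR_self_exp_le s0 y1 k0; rewrite -(ler_pM2l c20) => H1 H2.
have {H1 H2} := le_trans H1 H2.
set E := expR _; set Y := y ^+ _.
have Y0 : 0 < Y by rewrite exprn_gt0//; lra.
move: (pi : R) (@pi_gt0 R) => p p0.
rewrite (_ : c / 2 * (Y * E) = p * ((c / 2 / p * E) * Y)); last first.
  by field; rewrite gt_eqF.
by rewrite ler_pM2l// ler_pM2r.
Qed.

(** * Rotating the half-line of integration *)

Section rotation.
Context {R : realType}.
Variables (a al lam : R) (k : nat).
Hypothesis al_gt0 : 0 < al.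

(** With [r = (x - a) ^ al] and [z = exp (- lam * r * e ^ (i * th))], the complex
    number [damp * e ^ (i * phase)] is the conjugate of [z], multiplied by
    [e ^ (- i * th * (k + 1) / al)]: this factor compensates the rotation of the
    [k]-th moment of [z], so that the integral of [rot_kernel] should not depend on
    [th]. *)
Definition phase (th r : R) : R := lam * r * sin th - k.+1%:R / al * th.
Definition damp (th r : R) : R := expR (- (lam * r * cos th)).

Definition rot_kernel (th x : R) : R :=
  (x - a) ^+ k * (damp th ((x - a) `^ al) * sin (phase th ((x - a) `^ al))).
Definition rot_flux (th x : R) : R :=
  (x - a) ^+ k.+1 * (damp th ((x - a) `^ al) * cos (phase th ((x - a) `^ al))).
Definition rot_kernel_dangle (th x : R) : R :=
  (x - a) ^+ k * (damp th ((x - a) `^ al) *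
    (lam * (x - a) `^ al * sin th * sin (phase th ((x - a) `^ al)) +
     (lam * (x - a) `^ al * cos th - k.+1%:R / al) * cos (phase th ((x - a) `^ al)))).

Lemma is_derive_rot_kernel (th x : R) :
  is_derive th 1 (fun t => rot_kernel t x) (rot_kernel_dangle th x).
Proof.
rewrite /rot_kernel /rot_kernel_dangle /damp /phase; set r := (x - a) `^ al.
apply: is_derive_eq.
rewrite /GRing.scale /=; ring.
Qed.

(** The derivative of [rot_kernel] in the angle is an exact derivative in [x]: this
    is the Cauchy-Riemann equation for a function of [(x - a) ^ al * e ^ (i * th)],
    as [x - a] times the derivative of [(x - a) ^ al] is [al * (x - a) ^ al]. *)
Lemma is_derive_rot_flux (th x : R) : a < x ->
  is_derive x 1 (rot_flux th) (- al * rot_kernel_dangle th x).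
Proof.
move=> ax; have xa : 0 < x - a by rewrite subr_gt0.
rewrite /rot_flux /rot_kernel_dangle /damp /phase.
have dr : is_derive x 1 (fun y => (y - a) `^ al) (al * (x - a) `^ (al - 1)).
  have := @is_derive1_comp R (fun z => z `^ al) (fun y => y - a) x
     (al * (x - a) `^ (al - 1)) 1 (is_derive1_powR al xa).
  rewrite mulr1; apply.
  by apply: is_derive_eq; rewrite subr0.
have rE : (x - a) `^ al = (x - a) * (x - a) `^ (al - 1).
  by rewrite mulr_powRB1// ltW.
have key (r : R -> R) (dr1 : R) : is_derive x 1 r dr1 ->
  is_derive x 1 (fun y => (y - a) ^+ k.+1 * (expR (- (lam * r y * cos th)) *
      cos (lam * r y * sin th - k.+1%:R / al * th)))
   (expR (- (lam * r x * cos th)) * (x - a) ^+ k *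
     (k.+1%:R * cos (lam * r x * sin th - k.+1%:R / al * th)
      - (x - a) * dr1 * lam * (cos th * cos (lam * r x * sin th - k.+1%:R / al * th)
        + sin th * sin (lam * r x * sin th - k.+1%:R / al * th)))).
  move=> dr'.
  have dX : is_derive x 1 (fun y : R => (y - a) ^+ k.+1) (k.+1%:R * (x - a) ^+ k).
    have dB : is_derive x 1 (fun y : R => y - a) 1.
      by apply: is_derive_eq; rewrite subr0.
    have := is_deriveX k.+1 dB.
    by rewrite exprfctE /GRing.scale /= mulr1.
  apply: is_derive_eq.
  rewrite /GRing.scale /= exprS; ring.
apply: (is_derive_eq (key _ _ dr)).
rewrite /= rE; set q := _ `^ _.
by field; exact: lt0r_neq0.
Qed.

Lemma within_continuous_monomial_powR (n : nat) (G : R -> R) : continuous G ->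
  {within `[a, +oo[, continuous (fun x : R => (x - a) ^+ n * G ((x - a) `^ al))}.
Proof.
move=> cG.
have cr : {within `[a, +oo[, continuous (fun x : R => (x - a) `^ al)}.
  apply/continuous_within_itvcyP; split=> [x|].
    rewrite in_itv /= andbT -subr_gt0 => xa.
    apply: (@continuous_comp _ _ _ (fun y : R => y - a) (fun z => z `^ al)).
      by apply: cvgB; [exact: cvg_id|exact: cvg_cst].
    apply/differentiable_continuous/derivable1_diffP.
    by apply: derivable_powR; rewrite in_itv /= xa.
  rewrite subrr powR0 ?gt_eqF//.
  apply: (@cvg_comp _ _ _ (fun y : R => y - a) (fun z => z `^ al) _ 0^'+);
    last exact: powR_cvg0.
  move=> P [e /= e0 eP]; exists e => //= y ye ay; apply: eP => /=.
    by rewrite sub0r opprB.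
  by rewrite subr_gt0.
move=> x; apply: cvgM; last first.
  by apply: (@within_continuous_comp _ _ _ _ _ G) cr x => z _; exact: cG.
have cX : continuous (fun y : R => (y - a) ^+ n).
  move=> y; apply: (@continuous_comp _ _ _ (fun y : R => y - a) (fun z => z ^+ n)).
    by apply: cvgB; [exact: cvg_id|exact: cvg_cst].
  exact: exprn_continuous.
exact: (continuous_subspaceT cX).
Qed.

Lemma within_continuous_rot_kernel th : {within `[a, +oo[, continuous (rot_kernel th)}.
Proof.
apply: (@within_continuous_monomial_powR k (fun r => damp th r * sin (phase th r))).
move=> r; apply/differentiable_continuous/derivable1_diffP.
by rewrite /damp /phase; apply: ex_derive.
Qed.

Lemma within_continuous_rot_flux th : {within `[a, +oo[, continuous (rot_flux th)}.
Proof.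
apply: (@within_continuous_monomial_powR k.+1 (fun r => damp th r * cos (phase th r))).
move=> r; apply/differentiable_continuous/derivable1_diffP.
by rewrite /damp /phase; apply: ex_derive.
Qed.

Lemma within_continuous_rot_kernel_dangle th : {within `[a, +oo[, continuous (rot_kernel_dangle th)}.
Proof.
apply: (@within_continuous_monomial_powR k (fun r => damp th r *
  (lam * r * sin th * sin (phase th r) +
     (lam * r * cos th - k.+1%:R / al) * cos (phase th r)))).
move=> r; apply/differentiable_continuous/derivable1_diffP.
by rewrite /damp /phase; apply: ex_derive.
Qed.

Lemma integral_rot_kernel_dangle (th N : R) : a < N ->
  (\int[lebesgue_measure]_(x in `[a, N]) (rot_kernel_dangle th x)%:E
   = (- (al^-1 * rot_flux th N))%:E)%E.
Proof.
move=> aN.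
have cF : {within `[a, +oo[, continuous (fun x => - al^-1 * rot_flux th x)}.
  by move=> x; apply: cvgM; [exact: cvg_cst|exact: within_continuous_rot_flux].
have dF x : a < x -> is_derive x 1 (fun x => - al^-1 * rot_flux th x) (rot_kernel_dangle th x).
  move=> ax; have dR := is_derive_rot_flux th ax.
  apply: (is_derive_eq (is_deriveZ (- al^-1) dR)).
  by rewrite /GRing.scale /= mulrA mulrNN mulVf ?mul1r// gt_eqF.
rewrite (@continuous_FTC2 _ _ (fun x => - al^-1 * rot_flux th x)) //.
- by rewrite -EFinB [in X in _ - X]/rot_flux subrr expr0n /= mul0r mulr0 subr0 mulNr.
- by apply: continuous_subspaceW (@within_continuous_rot_kernel_dangle th); exact: subset_itvl.
- split.
  + by move=> x /[!in_itv] /= /andP[ax _]; case: (dF x ax).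
  + by move/continuous_within_itvcyP : cF => [].
  + apply: cvg_at_left_filter.
    suff : {for N, continuous (fun x : R => - al^-1 * rot_flux th x)} by [].
    apply: differentiable_continuous; apply/derivable1_diffP.
    by case: (dF N aN).
- move=> x /[!in_itv] /= /andP[ax _].
  by rewrite derive1E; case: (dF x ax).
Qed.

(** A bound that is uniform in the angle, for differentiating under the
    integral over a bounded interval; it grows with [x]. *)
Lemma norm_rot_kernel_dangle_le th x : a <= x ->
  `|rot_kernel_dangle th x| <= (x - a) ^+ k * (expR (`|lam| * (x - a) `^ al) *
     (`|lam| * (x - a) `^ al + (`|lam| * (x - a) `^ al + k.+1%:R / al))).
Proof.
move=> ax; set r := (x - a) `^ al.
have r0 : 0 <= r by exact: powR_ge0.
have bnd (u v : R) : `|v| <= 1 -> `|u * v| <= `|u|.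
  by move=> v1; rewrite normrM ler_piMr.
have lr0 : 0 <= `|lam| * r by rewrite mulr_ge0.
have lrE : `|lam * r| = `|lam| * r by rewrite normrM (ger0_norm r0).
rewrite /rot_kernel_dangle -/r normrM ger0_norm ?exprn_ge0 ?subr_ge0//.
rewrite ler_wpM2l ?exprn_ge0 ?subr_ge0// normrM ler_pM//.
  rewrite /damp ger0_norm ?expR_ge0// ler_expR.
  rewrite (le_trans (ler_norm _))// normrN -lrE; exact: bnd (cos_max _).
rewrite (le_trans (ler_normD _ _))// lerD//.
  by rewrite (le_trans (bnd _ _ (sin_max _)))// -lrE; exact: bnd (sin_max _).
rewrite (le_trans (bnd _ _ (cos_max _)))// (le_trans (ler_normB _ _))//.
rewrite lerD//; first by rewrite -lrE; exact: bnd (cos_max _).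
by rewrite ger0_norm// divr_ge0// ltW.
Qed.

(** Only the boundary term at [N] survives, since [rot_flux] vanishes at [a]. *)
Lemma is_derive_integral_rot_kernel (N th : R) : a < N ->
  is_derive th 1 (fun t => \int[lebesgue_measure]_(x in `[a, N]) rot_kernel t x)
    (- (al^-1 * rot_flux th N)).
Proof.
move=> aN.
pose G (x : R) := (x - a) ^+ k * (expR (`|lam| * (x - a) `^ al) *
     (`|lam| * (x - a) `^ al + (`|lam| * (x - a) `^ al + k.+1%:R / al))).
have cint (g : R -> R) : {within `[a, +oo[, continuous g} ->
    lebesgue_measure.-integrable `[a, N] (EFin \o g).
  move=> cg; apply: continuous_compact_integrable; first exact: segment_compact.
  by apply: continuous_subspaceW cg; exact: subset_itvl.
have aI : `](th - 1), (th + 1)[%classic th by rewrite /= in_itv /=; lra.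
have i1 t : `](th - 1), (th + 1)[%classic t ->
   lebesgue_measure.-integrable `[a, N] (EFin \o rot_kernel t).
  by move=> _; apply: cint; exact: within_continuous_rot_kernel.
have i2 t x : `](th - 1), (th + 1)[%classic t -> `[a, N]%classic x ->
    derivable (rot_kernel ^~ x) t 1.
  by move=> _ _; case: (is_derive_rot_kernel t x).
have i3 : forall x, 0 <= `|G x| by [].
have i4 : lebesgue_measure.-integrable `[a, N] (EFin \o (fun x => `|G x|)).
  apply: integrable_norm; apply: cint.
  apply: (@within_continuous_monomial_powR k (fun r => expR (`|lam| * r) *
     (`|lam| * r + (`|lam| * r + k.+1%:R / al)))).
  move=> r; apply/differentiable_continuous/derivable1_diffP.
  exact: ex_derive.
have d1E t x : partial1of2 rot_kernel t x = rot_kernel_dangle t x.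
  by rewrite partial1of2E; case: (is_derive_rot_kernel t x).
have i5 t x : `](th - 1), (th + 1)[%classic t -> `[a, N]%classic x ->
    `|partial1of2 rot_kernel t x| <= `|G x|.
  move=> _; rewrite /= in_itv /= => /andP[ax _]; rewrite d1E.
  by rewrite (le_trans (norm_rot_kernel_dangle_le t ax))// ler_norm.
have := @derivable_under_integral R _ _ lebesgue_measure rot_kernel _ (measurable_itv `[a, N])
   _ _ _ aI i1 i2 _ i3 i4 i5.
have := @differentiation_under_integral R _ _ lebesgue_measure rot_kernel _ (measurable_itv `[a, N])
   _ _ _ aI i1 i2 _ i3 i4 i5.
move=> dE dv; apply: DeriveDef => //.
rewrite -derive1E dE /Rintegral.
under eq_integral do rewrite d1E.
by rewrite integral_rot_kernel_dangle.
Qed.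

End rotation.

(** * A bounded function with vanishing moments *)

Lemma cvg_integral_itvcy (R : realType) (g : R -> R) (a : R) :
  lebesgue_measure.-integrable `[a, +oo[ (EFin \o g) ->
  (\int[lebesgue_measure]_(x in `[a, (a + n%:R)%R]) (g x)%:E)%E @[n --> \oo]
    --> (\int[lebesgue_measure]_(x in `[a, +oo[) (g x)%:E)%E.
Proof.
move=> ig.
pose g_ (n : nat) := (EFin \o g) \_ `[a, a + n%:R].
have E n : (\int[lebesgue_measure]_(x in `[a, (a + n%:R)%R]) (g x)%:E =
    \int[lebesgue_measure]_(x in `[a, +oo[) g_ n x)%E.
  rewrite -integral_mkcondr; congr (integral _ _ _).
  apply/seteqP; split=> x /=; rewrite !in_itv /= ?andbT; last by case.
  by move=> /andP[-> ->].
under eq_fun do rewrite E.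
have mg := measurable_int _ ig.
apply: (@dominated_cvg _ _ _ lebesgue_measure _ _ g_ _ (fun x => `|(g x)%:E|%E)) => //.
- move=> n; apply: (measurable_int lebesgue_measure).
  apply/integrable_restrict => //.
  by apply: integrableS ig => //; exact: measurableI.
- move=> x; rewrite /= in_itv /= andbT => ax.
  apply: cvg_near_cst; near=> n.
  rewrite /g_ patchE mem_set//= in_itv /= ax /= -lerBlDl.
  by near: n; exact: nbhs_infty_ger.
- exact: integrable_abse.
- move=> n x ax; rewrite /g_ patchE; case: ifPn => //= _.
  by rewrite normr0 lee_fin.
Unshelve. all: end_near. Qed.

(** The exponential dominates a power of its argument so large that it exceeds
    [n ^ (m + 1)]. *)
Lemma cvg_expn_expR_powR (R : realType) (al c : R) (m : nat) : 0 < al -> 0 < c ->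
  n%:R ^+ m * expR (- (c * n%:R `^ al)) @[n --> \oo] --> (0 : R).
Proof.
move=> al0 c0.
have [p pE] : exists p : nat, m.+1%:R / al <= p.+1%:R.
  exists (Num.truncn (m.+1%:R / al)).
  by apply: ltW; apply: truncnS_gt.
pose K := p.+1`!%:R / c ^+ p.+1.
apply: (@squeeze_cvgr _ _ _ _ (cst 0) (fun n => K / n%:R)); last 2 first.
- exact: cvg_cst.
- rewrite -[X in _ --> X](mulr0 K); apply: cvgM; first exact: cvg_cst.
  rewrite -cvg_shiftS.
  exact: cvg_harmonic.
near=> n.
have n0 : (0 < n)%N by near: n; exact: nbhs_infty_gt.
have n1 : 1 <= n%:R :> R by rewrite ler1n.
have n0' : 0 < n%:R :> R by rewrite ltr0n.
rewrite mulr_ge0 ?exprn_ge0 ?expR_ge0//=.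
rewrite expRN ler_pdivrMr ?expR_gt0//.
have s0 : 0 <= c * n%:R `^ al by rewrite mulr_ge0 ?ltW// powR_gt0.
have h : (c * n%:R `^ al) ^+ p.+1 / p.+1`!%:R <= expR (c * n%:R `^ al).
  by rewrite (le_trans _ (expR_ge1Dxn p s0))// lerDr.
have h2 : n%:R ^+ m.+1 <= (n%:R `^ al) ^+ p.+1.
  rewrite -(powR_mulrn _ (ltW n0')) -(powR_mulrn _ (powR_ge0 _ _)) -powRrM.
  by rewrite ler_powR// mulrC -ler_pdivrMr.
apply: (@le_trans _ _ (K / n%:R * ((c * n%:R `^ al) ^+ p.+1 / p.+1`!%:R))); last first.
  by rewrite ler_wpM2l// divr_ge0 ?divr_ge0 ?exprn_ge0 ?ler0n// ltW.
rewrite (_ : K / n%:R * _ = (n%:R `^ al) ^+ p.+1 / n%:R); last first.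
  have c1 : c ^+ p.+1 != 0 by rewrite gt_eqF ?exprn_gt0.
  have p1 : p.+1`!%:R != 0 :> R by rewrite gt_eqF// ltr0n fact_gt0.
  rewrite /K exprMn; move: (c ^+ p.+1) (p.+1`!%:R) ((n%:R `^ al) ^+ p.+1) c1 p1 => C F Q C0 F0.
  by field; rewrite C0 F0 gt_eqF.
by rewrite ler_pdivlMr// -exprSr.
Unshelve. all: end_near. Qed.

Section null_moments.
Context {R : realType}.
Variables (a al lam : R).
Hypotheses (al_gt0 : 0 < al) (al_lt : al < 2^-1) (lam_gt0 : 0 < lam).

(** Up to conjugation, the imaginary part of
    [exp (- lam * (x - a) ^ al * e ^ (i * pi * al))]. *)
Definition null_kernel (x : R) : R :=
  expR (- (lam * cos (pi * al) * (x - a) `^ al)) *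
  sin (lam * sin (pi * al) * (x - a) `^ al).

Let thmax : 0 < pi * al < pi / 2.
Proof. by rewrite mulr_gt0 ?pi_gt0//= ltr_pM2l ?pi_gt0. Qed.

Lemma cos_pial_gt0 : 0 < cos (pi * al).
Proof. by apply: cos_gt0_pihalf; have := thmax; have := @pi_gt0 R; lra. Qed.

(** At the angle [pi * al] the correction of the phase is [(k + 1) * pi], whatever
    [k] is. *)
Lemma rot_kernel_pial k x : rot_kernel a al lam k (pi * al) x =
  (-1) ^+ k.+1 * ((x - a) ^+ k * null_kernel x).
Proof.
rewrite /rot_kernel /null_kernel /damp /phase.
set r := (x - a) `^ al.
have -> : lam * r * sin (pi * al) - k.+1%:R / al * (pi * al) =
    lam * sin (pi * al) * r - pi *+ k.+1.
  by rewrite -mulr_natl; field; rewrite gt_eqF.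
have := alternatingn (@sinDpi R) k.+1 (lam * sin (pi * al) * r - pi *+ k.+1).
rewrite subrK => sE.
rewrite (_ : lam * r * cos (pi * al) = lam * cos (pi * al) * r); last by ring.
by rewrite sE -signr_odd; case: (odd _); rewrite ?expr0 ?expr1; ring.
Qed.

(** Mean value theorem in the angle between [0], where the kernel vanishes, and
    [pi * al]; the cosine is smallest at [pi * al]. *)
Lemma norm_integral_rot_kernel_le k (N : R) : a < N ->
  `|\int[lebesgue_measure]_(x in `[a, N]) rot_kernel a al lam k (pi * al) x| <=
  pi * ((N - a) ^+ k.+1 * expR (- (lam * cos (pi * al) * (N - a) `^ al))).
Proof.
move=> aN.
have [th0 thpi] := andP thmax.
have dD th := @is_derive_integral_rot_kernel R a al lam k al_gt0 N th aN.
pose D th := \int[lebesgue_measure]_(x in `[a, N]) rot_kernel a al lam k th x.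
have [|th] := @MVT_segment R D _ 0 (pi * al) (ltW th0) (fun x _ => dD x).
  apply: derivable_within_continuous => th _.
  by case: (dD th).
rewrite in_itv /= => /andP[th_ge0 th_le].
have -> : D 0 = 0.
  rewrite /D; under eq_Rintegral.
    by move=> x _; rewrite /rot_kernel /phase sin0 !mulr0 subrr sin0 !mulr0; over.
  by rewrite /Rintegral integral0.
rewrite !subr0 /D => ->.
rewrite normrM normrN normrM (ger0_norm (ltW th0)) mulrC.
rewrite (_ : pi * al * _ = pi * (al * (`|al^-1| * `|rot_flux a al lam k th N|))); last by ring.
rewrite ler_pM2l ?pi_gt0// gtr0_norm ?invr_gt0// mulrA divff ?gt_eqF// mul1r.
have Na : 0 <= N - a by rewrite subr_ge0 ltW.
rewrite /rot_flux normrM ger0_norm ?exprn_ge0// ler_wpM2l ?exprn_ge0//.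
rewrite normrM -[leRHS]mulr1 ler_pM// ?cos_max//.
rewrite /damp ger0_norm ?expR_ge0// ler_expR lerN2.
rewrite [leRHS]mulrAC -!mulrA ler_pM2l// ler_wpM2r ?powR_ge0//.
have [->//|nth] := eqVneq th (pi * al).
apply: ltW; rewrite ltr_cos ?in_itv /=; first by rewrite lt_neqAle nth.
  by have := @pi_gt0 R; lra.
by have := @pi_gt0 R; lra.
Qed.

Lemma integral_shifted_moment_null_kernel k :
  lebesgue_measure.-integrable `[a, +oo[ (fun x => ((x - a) ^+ k * null_kernel x)%:E) ->
  (\int[lebesgue_measure]_(x in `[a, +oo[) ((x - a) ^+ k * null_kernel x)%:E = 0)%E.
Proof.
move=> ig.
have /fine_cvg cvg1 : (\int[lebesgue_measure]_(x in `[a, (a + n%:R)%R])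
      ((x - a) ^+ k * null_kernel x)%:E)%E @[n --> \oo] -->
    (\int[lebesgue_measure]_(x in `[a, +oo[) ((x - a) ^+ k * null_kernel x))%R%:E.
  rewrite /Rintegral fineK ?integrable_fin_num//.
  exact: (@cvg_integral_itvcy _ (fun x => (x - a) ^+ k * null_kernel x) _ ig).
rewrite -[LHS]fineK ?integrable_fin_num//; congr EFin.
apply: (cvg_unique _ cvg1) => //.
have cvg2 : pi * (n%:R ^+ k.+1 * expR (- (lam * cos (pi * al) * n%:R `^ al)))
    @[n --> \oo] --> (0 : R).
  rewrite -[X in _ --> X](mulr0 pi); apply: cvgM; first exact: cvg_cst.
  by apply: cvg_expn_expR_powR => //; rewrite mulr_gt0 ?cos_pial_gt0.
apply: norm_cvg0.
apply: (@squeeze_cvgr _ _ _ _ (cst 0) _ _ _ _ _ cvg2); last exact: cvg_cst.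
near=> n; rewrite normr_ge0 /=.
have an : a < a + n%:R by rewrite ltrDl ltr0n; near: n; exact: nbhs_infty_gt.
have := @norm_integral_rot_kernel_le k _ an.
rewrite (_ : a + n%:R - a = n%:R); last by ring.
apply: le_trans; rewrite le_eqVlt; apply/orP; left; apply/eqP.
under [in RHS]eq_Rintegral do rewrite rot_kernel_pial.
rewrite RintegralZl//.
  by rewrite normrM normrX normrN normr1 expr1n mul1r.
apply: integrableS ig => //; exact: subset_itvl.
Unshelve. all: end_near. Qed.

End null_moments.

Section null_kernel_facts.
Context {R : realType}.
Variables (a al lam : R).
Hypotheses (a_ge0 : 0 <= a) (al_gt0 : 0 < al) (al_lt : al < 2^-1) (lam_gt0 : 0 < lam).
Local Notation g := (null_kernel a al lam).

Lemma measurable_null_kernel : measurable_fun setT g.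
Proof.
have mr (C : R) : measurable_fun setT (fun x : R => C * (x - a) `^ al).
  apply: measurable_funM => //.
  have mB : measurable_fun setT (fun x : R => x - a) by exact: measurable_funB.
  exact: (measurableT_comp (measurable_powR al) mB).
apply: measurable_funM.
  by apply: measurableT_comp => //; apply: measurableT_comp => //; exact: mr.
have ms : measurable_fun setT (@sin R).
  by apply: continuous_measurable_fun; exact: continuous_sin.
exact: measurableT_comp ms (mr _).
Qed.

Lemma norm_null_kernel_le x :
  `|g x| <= expR (- (lam * cos (pi * al) * (x - a) `^ al)).
Proof.
rewrite /null_kernel normrM ger0_norm ?expR_ge0// -[leRHS]mulr1.
by rewrite ler_wpM2l ?expR_ge0 ?sin_max.
Qed.

(** The functions [x ^ n * (x - a) ^ k] are handled by induction on [n], writing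
    [x] as [(x - a) + a]. *)
Lemma integral_moment_null_kernel (j : nat) :
  (forall k, lebesgue_measure.-integrable `[a, +oo[ (fun x => (x ^+ k * g x)%:E)) ->
  (\int[lebesgue_measure]_(x in `[a, +oo[) (x ^+ j * g x)%:E = 0)%E.
Proof.
move=> ig.
have mg n k : measurable_fun (`[a, +oo[%classic : set R)
    (fun x : R => x ^+ n * ((x - a) ^+ k * g x)).
  apply: measurable_funTS; apply: measurable_funM; first exact: exprn_measurable.
  apply: measurable_funM; last exact: measurable_null_kernel.
  by apply: measurable_funX; exact: measurable_funB.
have ig2 n k : lebesgue_measure.-integrable `[a, +oo[
    (fun x => (x ^+ n * ((x - a) ^+ k * g x))%:E).
  apply: le_integrable (ig (n + k)%N) => //.
    by apply/measurable_EFinP; exact: mg.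
  move=> x /=; rewrite in_itv /= andbT => ax; rewrite lee_fin.
  rewrite mulrA exprD !normrM ler_wpM2r// ler_pM//.
  have x0 : 0 <= x := le_trans a_ge0 ax.
  have xa : 0 <= x - a by rewrite subr_ge0.
  rewrite !ger0_norm ?exprn_ge0// lerXn2r ?nnegrE//.
  by rewrite lerBlDr lerDl.
suff H n : forall k, (\int[lebesgue_measure]_(x in `[a, +oo[)
    (x ^+ n * ((x - a) ^+ k * g x))%:E = 0)%E.
  rewrite -[RHS](H j 0%N); apply: eq_integral => x _.
  by rewrite expr0 mul1r.
elim: n => [|n IH] k.
  under eq_integral do rewrite expr0 mul1r.
  apply: integral_shifted_moment_null_kernel => //.
  have := ig2 0%N k; apply: eq_integrable => // x _.
  by rewrite expr0 mul1r.
transitivity (\int[lebesgue_measure]_(x in `[a, +oo[)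
   ((x ^+ n * ((x - a) ^+ k.+1 * g x))%:E +
    a%:E * (x ^+ n * ((x - a) ^+ k * g x))%:E))%E.
  by apply: eq_integral => x _; rewrite -EFinM -EFinD !exprS; congr EFin; ring.
rewrite integralD//; last exact: integrableZl.
by rewrite IH integralZl// IH mule0 adde0.
Qed.

(** Close to [a] the argument of the sine lies between [0] and [pi], so the
    kernel is positive there. *)
Lemma integral_null_kernel_neq0 (l : R) : 0 < l -> lam * l `^ al <= 1 ->
  (\int[lebesgue_measure]_(x in `]a, (a + l)%R]) (g x)%:E)%E <> 0%E.
Proof.
move=> l0 ll1 I0.
have thlt : 0 < pi * al < pi.
  rewrite mulr_gt0 ?pi_gt0//=; move: (pi : R) (@pi_gt0 R) => p p0.
  rewrite -[ltRHS]mulr1 ltr_pM2l//. apply: lt_trans al_lt _. lra.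
have s0 : 0 < sin (pi * al) by exact: sin_gt0_pi.
have g0 x : x \in `]a, a + l] -> 0 < g x.
  rewrite in_itv /= => /andP[ax xl].
  rewrite /null_kernel mulr_gt0 ?expR_gt0//; apply: sin_gt0_pi.
  have xa : 0 < x - a by rewrite subr_gt0.
  rewrite !mulr_gt0 ?powR_gt0//=.
  apply: (@le_lt_trans _ _ 1); last by have := @pi_ge2 R; lra.
  apply: le_trans ll1; rewrite -mulrA ler_pM2l//.
  apply: (@le_trans _ _ ((x - a) `^ al)).
    by rewrite ler_piMl ?powR_ge0// sin_le1.
  rewrite ge0_ler_powR ?nnegrE ?(ltW al_gt0) ?(ltW xa) ?(ltW l0)//; lra.
have mg : measurable_fun (`]a, a + l]%classic : set R) (EFin \o g).
  by apply/measurable_EFinP/measurable_funTS; exact: measurable_null_kernel.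
have /ae_eq_integral_abs : (\int[lebesgue_measure]_(x in `]a, (a + l)%R]) `|(EFin \o g) x| = 0)%E.
  rewrite -[RHS]I0; apply: eq_integral => x; rewrite inE /= => xI.
  by rewrite ger0_norm// ltW// g0.
move=> /(_ (measurable_itv _) mg) [N [mN N0 sN]].
have : (lebesgue_measure (`]a, (a + l)%R]%classic : set R) <= lebesgue_measure N)%E.
  apply: le_measure; rewrite ?inE//.
  move=> x xI; apply: sN => /= /(_ xI) [] /eqP.
  by rewrite gt_eqF// g0.
rewrite N0 lebesgue_measure_itv /= lte_fin ltrDl l0 -EFinD lee_fin.
by lra.
Qed.

End null_kernel_facts.

(** * Moment indeterminacy *)

(** A ratio [t] in the unit interval satisfies [t <= t ^ al]. *)
Lemma powR_subadditive (R : realType) (u v al : R) : 0 <= u -> 0 <= v -> 0 < al -> al <= 1 ->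
  (u + v) `^ al <= u `^ al + v `^ al.
Proof.
move=> u0 v0 al0 al1.
have [uv|uv] := leP (u + v) 0.
  have -> : u + v = 0 by lra.
  by rewrite powR0 ?gt_eqF// addr_ge0// powR_ge0.
have key t : 0 <= t -> t <= u + v -> t / (u + v) * (u + v) `^ al <= t `^ al.
  move=> t0 tuv.
  have e : t / (u + v) * (u + v) = t by rewrite divfK// gt_eqF.
  rewrite -[in leRHS]e powRM ?divr_ge0 ?(ltW uv)// ler_wpM2r ?powR_ge0//.
  have [->|t_neq0] := eqVneq t 0; first by rewrite mul0r powR_ge0.
  have tgt0 : 0 < t by rewrite lt_def t_neq0.
  rewrite ger1_powR// divr_gt0//=.
  by rewrite ler_pdivrMr// mul1r.
have ku := key u u0 ltac:(lra); have kv := key v v0 ltac:(lra).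
apply: le_trans (lerD ku kv); rewrite -mulrDl -mulrDl divff ?mul1r//.
by rewrite gt_eqF.
Qed.

Theorem theorem2 (R : realType) (d : measure_display) (T : measurableType d)
    (P : probability T R) (X : {RV P >-> R})
    (X_ge0 : {ae P, forall t, 0 <= X t})
    (X_moments : finite_moments P X)
    (c eps : R) (c_gt0 : 0 < c) (eps_gt0 : 0 < eps)
    (moment_growth : forall k : nat, (0 < k)%N ->
       ((c * (k%:R `^ ((2 + eps) * k%:R)))%:E <= moment P X k)%E)
    (f : R -> R) (f_density : has_density_on_nneg X f)
    (f_L : condition_L f) :
  M_indet X.
Proof.
have [x1 [C [x1_ge1 C0 fC]]] :=
  density_ge_expR_powR X_moments c_gt0 eps_gt0 moment_growth f_density f_L.
pose al := (2 + eps)^-1.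
have s0 : 0 < 2 + eps by lra.
have al0 : 0 < al by rewrite invr_gt0.
have al_lt : al < 2^-1 by rewrite ltf_pV2 ?posrE//; lra.
have x1_ge0 : 0 <= x1 by lra.
have b0 := cos_pial_gt0 al0 al_lt.
(* With this [lam] the kernel decays at the same rate as the lower bound of [f]. *)
pose lam := 4 * (2 + eps) / cos (pi * al).
have lam0 : 0 < lam by rewrite divr_gt0// mulr_gt0.
(* By subadditivity of [x ^ al], translating the kernel by [x1] costs a constant
   factor. *)
pose del := C * expR (- (4 * (2 + eps) * x1 `^ al)).
have del0 : 0 < del by rewrite mulr_gt0 ?expR_gt0.
pose g := null_kernel x1 al lam.
have gf x : x1 <= x -> del * `|g x| <= f x.
  move=> x1x; apply: le_trans (fC x x1x).
  have := @norm_null_kernel_le R x1 al lam x.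
  rewrite -/g -(ler_pM2l del0) => /le_trans; apply.
  rewrite /del -[leLHS]mulrA (ler_pM2l C0) -expRD ler_expR.
  rewrite (_ : lam * cos (pi * al) = 4 * (2 + eps)); last first.
    by rewrite /lam divfK// gt_eqF.
  rewrite -opprD lerN2 -mulrDr ler_pM2l ?mulr_gt0//.
  rewrite -/al -[X in X `^ _ <= _](subrK x1) addrC.
  apply: powR_subadditive => //; [by rewrite subr_ge0|lra].
pose h : R -> R := (fun x => del * g x) \_ `[x1, +oo[.
pose w : R -> R := f \_ `[0, +oo[.
have mw : measurable_fun setT w := measurable_density f_density.
have w0 : forall x, 0 <= w x := density_ge0 f_density.
have wE : forall A : set R, measurable A ->
   P (X @^-1` A) = (\int[lebesgue_measure]_(x in A) (w x)%:E)%E := law_density f_density.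
have mh : measurable_fun setT h.
  apply/(measurable_restrict _ _ _).1 => //; rewrite setTI.
  by apply: measurable_funTS; apply: measurable_funM => //; exact: measurable_null_kernel.
have hw x : `|h x| <= w x.
  rewrite {1}/h patchE; case: ifPn => [|_]; last by rewrite normr0.
  rewrite inE /= in_itv /= andbT => x1x.
  rewrite /w patchE mem_set /= ?in_itv /= ?andbT ?(le_trans x1_ge0)//.
  by rewrite normrM gtr0_norm// gf.
have hE (A : set R) (p : R -> R) : (\int[lebesgue_measure]_(x in A) (p x * h x)%:E =
    \int[lebesgue_measure]_(x in A `&` `[x1, +oo[) (p x * (del * g x))%:E)%E.
  rewrite integral_mkcondr; apply: eq_integral => x _.
  by rewrite /h !patchE; case: ifPn => // _; rewrite mulr0.
have ig k : lebesgue_measure.-integrable `[x1, +oo[ (fun x => (x ^+ k * g x)%:E).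
  have i1 := integrable_moment_density X_moments mw w0 wE k.
  have i2 : lebesgue_measure.-integrable `[x1, +oo[ (fun x => (del^-1)%:E * (x ^+ k * w x)%:E)%E.
    by apply: integrableZl => //; apply: integrableS i1.
  apply: le_integrable i2 => //.
    apply/measurable_EFinP/measurable_funTS/measurable_funM; first exact: exprn_measurable.
    exact: measurable_null_kernel.
  move=> x /=; rewrite in_itv /= andbT => x1x.
  rewrite lee_fin [in leRHS]mulrCA (normrM _ (g x)) (normrM _ (del^-1 * w x)) (normrM del^-1) ler_wpM2l//.
  rewrite [`|del^-1|]gtr0_norm ?invr_gt0// -(ler_pM2l del0) [leRHS]mulrA divff ?gt_eqF// mul1r.
  rewrite /w patchE mem_set /= ?in_itv /= ?andbT ?(le_trans x1_ge0)//.
  by rewrite (le_trans (gf _ x1x))// ler_norm.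
have h0 k : (\int[lebesgue_measure]_x (x ^+ k * h x)%:E = 0)%E.
  rewrite hE setTI.
  transitivity (\int[lebesgue_measure]_(x in `[x1, +oo[) (del%:E * (x ^+ k * g x)%:E))%E.
    by apply: eq_integral => x _; rewrite -EFinM mulrCA.
  rewrite integralZl// integral_moment_null_kernel// ?mule0//.
(* The kernel is positive on an interval of length [l] after [x1]. *)
pose l := lam^-1 `^ al^-1.
have l0 : 0 < l by rewrite powR_gt0// invr_gt0.
have ll : lam * l `^ al <= 1.
  by rewrite -powRrM mulVf ?gt_eqF// powRr1 ?invr_ge0 ?(ltW lam0)// divff// gt_eqF.
apply: (@M_indet_perturbation _ _ _ _ X X_moments w mw w0 wE h `]x1, x1 + l]%classic) => //.
move=> I0; apply: (@integral_null_kernel_neq0 R x1 al lam al0 al_lt lam0 l l0 ll).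
have : (\int[lebesgue_measure]_(x in `]x1, (x1 + l)%R]) (del%:E * (g x)%:E) = 0)%E.
  rewrite -[RHS]I0.
  under [RHS]eq_integral do rewrite -[h _]mul1r.
  rewrite hE setIidl; last first.
    by move=> x /=; rewrite !in_itv /= andbT => /andP[/ltW].
  by apply: eq_integral => x _; rewrite mul1r.
rewrite integralZl//; last first.
  have iE : lebesgue_measure.-integrable `[x1, +oo[ (EFin \o g).
    by apply: eq_integrable (ig 0%N) => // x _; rewrite expr0 mul1r.
  apply: integrableS iE => //.
    by move=> x /=; rewrite !in_itv /= andbT => /andP[/ltW].
by move=> /eqP; rewrite mule_eq0 eqe gt_eqF//= => /eqP.
Qed.
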